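(* Let $D\subseteq\{1,2,3,\dots\}$ be an infinite set. If a finite hypergraph is realizable by a family of axis-parallel rectangles whose $y$-projections form a nested family, then it is realizable by finite arithmetic progressions whose difference is in $D$.
   Context: A hypergraph $H=(V,E)$ has a finite vertex set $V$ and an edge set $E$ consisting of subsets of $V$. An axis-parallel rectangle is a set $\{(x,y): x_1\le x\le x_2,\ y_1\le y\le y_2\}$; its $y$-projection is $[y_1,y_2]$. A family of intervals (repetitions allowed) is nested if any two members $A,B$ satisfy $A\subseteq B$, $B\subseteq A$ or $A\cap B=\emptyset$. For $P\subset\mathbb{R}^2$ and a family $\mathcal{F}$ of planar sets, $H(P,\mathcal{F})$ is the hypergraph with vertex set $P$ and edge set $\{P\cap F: F\in\mathcal{F}\}$. $H$ is realizable by a family of rectangles with nested $y$-projections if there exist a finite $P\subset\mathbb{R}^2$, such a family $\mathcal{R}$, and a bijection $\varphi:V\to P$ mapping $E$ onto the edge set of $H(P,\mathcal{R})$. A finite arithmetic progression with difference $d$ is a set $\{a,a+d,\dots,a+(\ell-1)d\}$ with $a\in\mathbb{Z}$, $\ell\ge1$. $H$ is realizable by arithmetic progressions whose difference is in $D$ if there exist $W\subset\mathbb{Z}$, a family $\mathcal{A}$ of finite arithmetic progressions with differences in $D$, and a bijection $\varphi:V\to W$ mapping $E$ onto $\{A\cap W: A\in\mathcal{A}\}$. *)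

(* Defs.v *)
From mathcomp Require Import all_boot all_order all_algebra.
From mathcomp Require Import all_classical reals.

Set Implicit Arguments.
Unset Strict Implicit.
Unset Printing Implicit Defensive.

Import Order.TTheory GRing.Theory Num.Theory.

Local Open Scope classical_set_scope.
Local Open Scope ring_scope.

Record hypergraph := Hypergraph {
  vertex : finType;
  edges : {set {set vertex}}
}.

(* The edge set of H(P, F). *)
Definition trace_edges (T : Type) (P : set T) (F : set (set T)) :
    set (set T) :=
  [set P `&` A | A in F].

Definition realizes (H : hypergraph) (T : Type) (P : set T) (F : set (set T))
    (phi : vertex H -> T) : Prop :=
  set_bij [set: vertex H] P phi /\
  [set phi @` [set` e] | e in [set` edges H]] = trace_edges P F.

(* Degenerate rectangles (segments, points) are allowed, empty ones are not. *)
Record rectangle (R : realType) := Rectangle {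
  xmin : R; xmax : R; ymin : R; ymax : R;
  xmin_le_xmax : xmin <= xmax;
  ymin_le_ymax : ymin <= ymax
}.

Definition rectangle_set (R : realType) (r : rectangle R) : set (R * R) :=
  [set p | xmin r <= p.1 <= xmax r /\ ymin r <= p.2 <= ymax r].

Definition y_projection (R : realType) (r : rectangle R) : set R :=
  [set y | ymin r <= y <= ymax r].

(* An index type I lets members of the family be repeated. *)
Definition nested_family (I T : Type) (J : I -> set T) : Prop :=
  forall i j : I,
    [\/ J i `<=` J j, J j `<=` J i | J i `&` J j = set0].

Definition realizable_by_nested_rectangles (R : realType) (H : hypergraph) :
    Prop :=
  exists (P : set (R * R)) (I : Type) (r : I -> rectangle R)
         (phi : vertex H -> R * R),
    [/\ finite_set P,
        nested_family (fun i => y_projection (r i)) &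
        realizes P (range (fun i => rectangle_set (r i))) phi].

Definition arith_prog (a : int) (d l : nat) : set int :=
  [set a + (k * d)%:Z | k in [set k : nat | (k < l)%N]].

Definition finite_AP_with_difference_in (D : set nat) (A : set int) : Prop :=
  exists (a : int) (d l : nat), [/\ D d, (1 <= l)%N & A = arith_prog a d l].

Definition realizable_by_APs (D : set nat) (H : hypergraph) : Prop :=
  exists (W : set int) (F : set (set int)) (phi : vertex H -> int),
    F `<=` finite_AP_with_difference_in D /\ realizes W F phi.

(* Main.v *)
Require Import Defs.
From mathcomp Require Import all_boot all_order all_algebra.
From mathcomp Require Import all_classical reals.
From mathcomp Require Import zify.

(** The y-projections cut out a laminar family of vertex sets [S].  Processing
    the family from the outermost sets inwards, give each [S] a difference
    [d_S] in [D] exceeding every label used so far, and shift the labels of the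
    members of [S] by a large common multiple of the earlier differences: the
    earlier congruences survive, and [S] becomes exactly one residue class
    modulo [d_S].  Finally adding to each label a large multiple of all the
    differences, proportional to the rank of the vertex in the x-order, keeps
    all the residues and makes the placement increasing in x, so that the part
    of [S] between two abscissas is cut out by an arithmetic progression of
    difference [d_S]. *)

Set Implicit Arguments.
Unset Strict Implicit.

Import Order.TTheory GRing.Theory Num.Theory.

Local Open Scope classical_set_scope.

Lemma infinite_nat_unbounded (D : set nat) (n : nat) :
  infinite_set D -> exists2 d, D d & (n < d)%N.
Proof.
move=> Dinf; apply: contrapT => Dn; apply: Dinf.
apply: (@sub_finite_set _ _ `I_n.+1); last exact: finite_II.
by move=> d Dd /=; rewrite ltnS leqNgt; apply/negP => nd; apply: Dn; exists d.
Qed.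

Lemma fin_nat_bound (V : finType) (c : V -> nat) :
  exists2 B : nat, (0 < B)%N & forall v, (c v < B)%N.
Proof.
by exists (\max_v c v).+1 => // v; rewrite ltnS leq_bigmax.
Qed.

(** Points may share an abscissa; sorting breaks the ties, so the rank stays injective. *)
Lemma exists_monotone_rank (R : realType) (V : finType) (x : V -> R) :
  exists2 r : V -> nat, injective r &
    forall u v, (r u <= r v)%N -> (x u <= x v)%R.
Proof.
pose leV := relpre x <=%R; pose s := sort leV (enum V).
have s_all v : v \in s by rewrite mem_sort mem_enum.
exists (index^~ s) => [u v|u v]; first exact: index_inj.
apply: (@sorted_leq_index _ leV) => //.
- by move=> a b c; apply: le_trans.
- by move=> a; apply: lexx.
- by apply: sort_sorted => a b; apply: le_total.
Qed.

Definition nested_or_disjoint (V : finType) (A B : {set V}) : bool :=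
  (A \subset B) || [disjoint A & B].

(** Induction on the list, the tail being labelled before the head. The second conclusion is there
    for the induction: each set of the tail contains the head or misses it, so the earlier [c] is
    constant on the head. *)
Lemma residue_labelling (D : set nat) (V : finType) (s : seq {set V}) :
  infinite_set D -> pairwise (@nested_or_disjoint V) s ->
  exists (c : V -> nat) (M : nat),
    [/\ (0 < M)%N,
        forall u v, (forall A, A \in s -> (u \in A) = (v \in A)) -> c u = c v &
        forall A, A \in s -> exists d, [/\ D d, (d %| M)%N &
          forall v w, v \in A -> (w \in A) = (c w == c v %[mod d])]].
Proof.
move=> Dinf; elim: s => [_|S s IH /=]; first by exists (fun=> 0%N), 1%N; split.
case/andP=> /allP Ss /IH [c [M [M0 cC cP]]].
have [B B0 cB] := fin_nat_bound c.
(* A shift by [N] keeps residues modulo the earlier differences, which divide [M], and lifts the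
   labels on [S] above all others. *)
pose N := (M * B)%N.
have cN v : (c v < N)%N by have := cB v; rewrite /N; nia.
(* The new labels are all below [N + N], so congruence modulo [d] is equality of labels. *)
have [d Dd Nd] := infinite_nat_unbounded (N + N) Dinf.
exists (fun v => c v + (v \in S) * N)%N, (N * d)%N; split.
- by rewrite /N !muln_gt0 M0 B0 (leq_trans _ Nd).
- move=> u v uv; rewrite (uv S) ?mem_head// (cC u v)// => A As.
  by apply: uv; rewrite in_cons As orbT.
- move=> A; rewrite in_cons => /predU1P[->|As].
    exists d; split=> //; first exact: dvdn_mull.
    move=> v w vS; rewrite vS mul1n.
    rewrite !modn_small; try by have := cN v; have := cN w; case: (w \in S); lia.
    case: (boolP (w \in S)) => wS.
      rewrite mul1n (cC w v) ?eqxx// => T Ts.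
      have /orP[/fintype.subsetP ST|ST] := Ss _ Ts; first by rewrite !ST.
      by rewrite !(disjointFr ST).
    by have := cN w; lia.
  have [e [De eM eP]] := cP A As.
  have ceN v b : c v + b * N = c v %[mod e].
    by rewrite -modnDmr; have /eqP -> : (e %| b * N)%N;
      rewrite ?addn0// dvdn_mull// dvdn_mulr.
  exists e; split=> //; first by rewrite -mulnA dvdn_mulr.
  by move=> v w vA; rewrite (eP v w vA) !ceN.
Qed.

(** Sort by increasing cardinality: a later set contained in an earlier one must equal it. *)
Lemma laminar_sort_pairwise (V : finType) (L : {set {set V}}) :
  (forall A B, A \in L -> B \in L ->
     [|| A \subset B, B \subset A | [disjoint A & B]]) ->
  exists2 s, s =i L & pairwise (@nested_or_disjoint V) s.
Proof.
move=> Llam; pose leS := relpre (fun A : {set V} => #|A|) leq.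
have sL : sort leS (enum L) =i L by move=> A; rewrite mem_sort mem_enum.
exists (sort leS (enum L)) => //.
have : pairwise leS (sort leS (enum L)).
  rewrite -sorted_pairwise; last by move=> A B C; apply: leq_trans.
  by apply: sort_sorted => A B; apply: leq_total.
apply: (@sub_in_pairwise _ (mem L)); last by apply/allP => A; rewrite sL.
move=> A B AL BL /= AB; rewrite /nested_or_disjoint.
have /or3P[->//|BA|->] := Llam A B AL BL; last by rewrite orbT.
have /eqP -> : B == A by rewrite eqEcard BA.
by rewrite subxx.
Qed.

Lemma mem_arith_prog (m n d : nat) (w : nat) : (0 < d)%N -> (m <= n)%N ->
  arith_prog (Posz m) d ((n - m) %/ d).+1 (Posz w) <->
  (w = m %[mod d] /\ (m <= w <= m + (n - m) %/ d * d)%N).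
Proof.
move=> d0 mn; split=> [[k /= kl /eqP]|[/eqP wm /andP[mw wn]]].
  rewrite -PoszD eqz_nat => /eqP <-; split; first by rewrite addnC modnMDl.
  by rewrite leq_addr leq_add2l leq_mul2r -ltnS kl orbT.
have dw : (d %| w - m)%N by rewrite -eqn_mod_dvd.
exists ((w - m) %/ d)%N => /=.
  by rewrite ltnS -(@leq_pmul2r d)// divnK//; lia.
by rewrite divnK// -PoszD subnKC.
Qed.

Theorem theorem5 (R : realType) (D : set nat)
    (D_pos : D `<=` [set d : nat | (1 <= d)%N])
    (D_infinite : infinite_set D)
    (H : hypergraph) :
  realizable_by_nested_rectangles R H -> realizable_by_APs D H.
Proof.
move=> [P [I [r [phi [_ nested [[phiP phi_inj phi_surj] edgesE]]]]]].
set V := vertex H in phi phiP phi_inj phi_surj edgesE *.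
pose S i := [set v : V | (ymin (r i) <= (phi v).2 <= ymax (r i))%R]%SET.
pose L := [set A : {set V} | `[< exists i, A = S i >]]%SET.
have Llam A B : A \in L -> B \in L ->
    [|| A \subset B, B \subset A | [disjoint A & B]].
  rewrite !inE => -[i ->] [j ->].
  have [ij|ji|ij0] := nested i j.
  - by apply/or3P/Or31/fintype.subsetP => v; rewrite !inE => /ij.
  - by apply/or3P/Or32/fintype.subsetP => v; rewrite !inE => /ji.
  - apply/or3P/Or33/pred0P => v /=; apply/negP => /andP[]; rewrite !inE => vi vj.
    by have : set0 (phi v).2 by rewrite -ij0.
have [s sL /(@residue_labelling D _ _ D_infinite)] :=
  @laminar_sort_pairwise _ L Llam.
move=> [c [M [M0 _ cP]]].
have [x x_inj x_le] := exists_monotone_rank (fun v => (phi v).1).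
have [B B0 cB] := fin_nat_bound c.
(* The factor [M] preserves residues; [B] exceeds all values of [c], so one unit of rank outweighs
   any difference between them. *)
pose psi v := (c v + M * (B * x v))%N.
have psi_lt u v : (x u < x v)%N -> (psi u < psi v)%N.
  move=> xuv; have : (M * (B * (x u).+1) <= M * (B * x v))%N by rewrite !leq_mul.
  by rewrite mulnS mulnDr /psi; have := leq_pmull B M0; have := cB u; lia.
have psi_le u v : (psi u <= psi v)%N -> (x u <= x v)%N.
  by rewrite leqNgt => psi_uv; rewrite leqNgt; apply: contra psi_uv; apply: psi_lt.
have le_psi u v : (x u <= x v)%N -> (psi u <= psi v)%N.
  by rewrite leq_eqVlt => /predU1P[/x_inj->//|/psi_lt/ltnW].
have psi_inj : injective psi.
  move=> u v uv; apply/x_inj/eqP.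
  by rewrite eqn_leq !psi_le// uv.
have psi_mod d v : (d %| M)%N -> psi v = c v %[mod d].
  by move=> dM; rewrite /psi -modnDmr (eqP (dvdn_mulr _ dM)) addn0.
pose f v := Posz (psi v).
have f_inj : injective f by move=> u v /eqP; rewrite eqz_nat => /eqP/psi_inj.
(* With all progressions that trace an edge taken at once, it remains to trace every edge by some
   progression. *)
pose F := [set A | finite_AP_with_difference_in D A /\
  exists2 e, e \in edges H & f @` [set` e] = range f `&` A].
exists (range f), F, f; split; first by move=> A [].
split.
  split; [by move=> v _; exists v|by move=> u v _ _ /f_inj|by []].
rewrite /trace_edges; apply/seteqP; split=> [_ [e /= eH <-]|_ [A [_ [e eH eA]] <-]];
  last by exists e.
suff [A DA eA] : exists2 A, finite_AP_with_difference_in D A &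
    forall v, v \in e <-> A (f v).
  have fe : f @` [set` e] = range f `&` A.
    apply/seteqP; split=> [_ [v /= ve <-]|_ [[v _ <-] Av]].
      by split; [exists v|apply/eA].
    by exists v => //=; apply/eA.
  by exists A => //; split=> //; exists e.
have [v0 v0e|e0] := pickP (mem e); last first.
  have [d Dd _] := infinite_nat_unbounded 0 D_infinite.
  (* The empty edge: labels are natural numbers, so the one-term progression at -1 misses them. *)
  exists (arith_prog (-1) d 1); first by exists (-1)%R, d, 1%N.
  by move=> v; have := e0 v => /= ->; split=> // -[[|k] //=].
have [i ei] : exists i, forall v, v \in e <->
    v \in S i /\ (xmin (r i) <= (phi v).1 <= xmax (r i))%R.
  have : trace_edges P (range (fun i => rectangle_set (r i))) (phi @` [set` e]).
    by rewrite -edgesE; exists e.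
  move=> [_ [i _ <-] eE]; exists i => v; split.
    move=> ve; have : (phi @` [set` e]) (phi v) by exists v.
    by rewrite -eE inE => -[_ []].
  rewrite inE => -[yv xv]; have : (phi @` [set` e]) (phi v).
    by rewrite -eE; split; [exact: phiP|].
  by move=> [w /= we /phi_inj <-]; rewrite ?in_setT.
have [d [Dd dM dS]] : exists d, [/\ D d, (d %| M)%N &
    forall v w, v \in S i -> (w \in S i) = (c w == c v %[mod d])].
  by apply: cP; rewrite sL inE; apply/asboolP; exists i.
(* The progression will run from the vertex of least rank in [e] to that of greatest rank. *)
have [u ue u_min] := arg_minnP x v0e.
have [w we w_max] := arg_maxnP x v0e.
have uS : u \in S i by case/ei: ue.
have d0 := D_pos d Dd.
have uw : (psi u <= psi w)%N by exact/le_psi/u_min.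
exists (arith_prog (f u) d ((psi w - psi u) %/ d).+1).
  by exists (f u), d, ((psi w - psi u) %/ d).+1.
have psi_modS v : v \in S i -> psi v = psi u %[mod d].
  by move=> vS; rewrite !psi_mod//; apply/eqP; rewrite -dS.
have wE : (psi u + (psi w - psi u) %/ d * d)%N = psi w.
  have /eqP wu := psi_modS w (proj1 ((ei w).1 we)).
  by rewrite divnK ?subnKC// -eqn_mod_dvd.
move=> v; apply: iff_trans (iff_sym (mem_arith_prog _ d0 uw)); rewrite wE; split.
  move=> ve; split; first by apply: psi_modS; case/ei: ve.
  by rewrite !le_psi//; [exact: w_max|exact: u_min].
(* The residue puts [v] in [S i]; label order gives rank order, so its abscissa lies between those
   of [u] and [w]. *)
move=> [vu /andP[uv vw]]; apply/ei; split.
  by rewrite (dS u v uS) -!(psi_mod d)//; apply/eqP.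
have /ei[_ /andP[xu _]] := ue; have /ei[_ /andP[_ xw]] := we.
by rewrite (le_trans xu) ?(le_trans _ xw)//; apply/x_le/psi_le.
Qed.
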